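(* Let $\Gamma$ be the compression semigroup of the dual Vinberg cone $\Omega$. Then $\Gamma$ is contained in $\Upsilon$. Moreover, $\Gamma = \Gamma^+ G_0 \Gamma^-$, i.e. $\Gamma$ is exactly the set of all products $\gamma_+\, h\, \gamma_-$ with $\gamma_+\in\Gamma^+$, $h\in G_0$, $\gamma_-\in\Gamma^-$.
   Context: Let $V$ be the space of real symmetric matrices $x=\begin{pmatrix} x_1 & 0 & x_4 \\ 0 & x_2 & x_5 \\ x_4 & x_5 & x_3 \end{pmatrix}$, let $V'=\{\mathrm{diag}(u_1,u_2,0): u_1,u_2\in\mathbb{R}\}\subset V$, and let $\Omega=\{x\in V: x \text{ positive definite}\}$ (the dual Vinberg cone), with closure $\overline{\Omega}$ in $V$. Let $T_\Omega=V+i\Omega\subset V_{\mathbb{C}}$, and let $G(T_\Omega)$ be the identity component of the group of holomorphic automorphisms of $T_\Omega$. Let $H'$ be the set of real matrices $\begin{pmatrix} a_1 & 0 & 0 \\ 0 & a_2 & 0 \\ a_4 & a_5 & a_3 \end{pmatrix}$ with $a_3>0$, let $H=\{A\in H': a_1a_2\neq0\}$ (a group), and let $W$ be the set of real matrices $\begin{pmatrix} x_1 & 0 & x_6 \\ 0 & x_2 & x_7 \\ x_4 & x_5 & x_3 \end{pmatrix}$. Let $\mathrm{Sp}(6,\mathbb{R})=\{g\in \mathrm{GL}(6,\mathbb{R}): gJg^T=J\}$ with $J=\begin{pmatrix} 0 & -I \\ I & 0 \end{pmatrix}$, and $$G=\left\{\begin{pmatrix} A & B \\ C & D \end{pmatrix}\in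 \mathrm{Sp}(6,\mathbb{R}) : A\in H',\ B\in W,\ C\in V',\ D^T\in H'\right\},$$ a subgroup of $\mathrm{Sp}(6,\mathbb{R})$. The linear fractional action $g\cdot z=(Az+B)(Cz+D)^{-1}$ induces an isomorphism of $G$ onto $G(T_\Omega)$, by which the two groups are identified. For real points the action is given by the same formula wherever $Cx+D$ is invertible. Compression semigroup: $\Gamma=\{g\in G(T_\Omega): g\cdot\Omega\subset\Omega\}$, i.e. the $g\in G$ such that for every $x\in\Omega$ the matrix $Cx+D$ is invertible and $g\cdot x\in\Omega$. Notation: for $v\in V$, $t_v=\begin{pmatrix} I & v \\ 0 & I \end{pmatrix}$; for $A\in H$, $\rho(A)=\begin{pmatrix} A & 0 \\ 0 & A^{-T} \end{pmatrix}$ (acting by $x\mapsto AxA^T$), where $A^{-T}=(A^T)^{-1}$; for $u\in V'$, $\tilde t_u=\begin{pmatrix} I & 0 \\ -u & I \end{pmatrix}$. Put $G_0=\rho(H)$, $\Gamma^+=\{t_v: v\in\overline{\Omega}\}$, $\Gamma^-=\{\tilde t_{-u}: u\in\overline{\Omega}\cap V'\}$, and $\Upsilon=\{t_v\,\rho(A)\,\tilde t_u : v\in V,\ A\in H,\ u\in V'\}$. *)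

(* Defs.v *)
From HB Require Import structures.
From mathcomp Require Import all_boot all_order all_algebra.
From mathcomp Require Import all_classical all_reals all_analysis.

Set Implicit Arguments.
Unset Strict Implicit.
Unset Printing Implicit Defensive.

Import Order.TTheory GRing.Theory Num.Theory.
Import numFieldNormedType.Exports.

Local Open Scope classical_set_scope.
Local Open Scope ring_scope.

(* Throughout, the (mathematical) row or column number k = 1, 2, 3 is the
   index k - 1 : 'I_3, and 6 x 6 matrices are 2 x 2 block matrices in
   'M[R]_(3 + 3), whose blocks A, B, C, D are ulsubmx, ursubmx, dlsubmx and
   drsubmx. *)

Definition spaceV (R : realType) : set 'M[R]_3 :=
  [set x | x^T = x /\ x 0 1 = 0].

Definition spaceV' (R : realType) : set 'M[R]_3 :=
  [set u | is_diag_mx u /\ u 2 2 = 0].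

Definition posdefmx (R : realType) n (x : 'M[R]_n) : Prop :=
  x^T = x /\ forall w : 'cV[R]_n, w != 0 -> 0 < (w^T *m x *m w) 0 0.

(* The dual Vinberg cone. *)
Definition cone (R : realType) : set 'M[R]_3 :=
  [set x | spaceV x /\ posdefmx x].

(* The closure of the cone for the subspace topology of V. *)
Definition cone_closure (R : realType) : set 'M[R]_3 :=
  @spaceV R `&` closure (@cone R).

Definition setH' (R : realType) : set 'M[R]_3 :=
  [set A | [/\ A 0 1 = 0, A 1 0 = 0, A 0 2 = 0, A 1 2 = 0 & 0 < A 2 2]].

Definition groupH (R : realType) : set 'M[R]_3 :=
  [set A | setH' A /\ A 0 0 * A 1 1 != 0].

Definition spaceW (R : realType) : set 'M[R]_3 :=
  [set x | x 0 1 = 0 /\ x 1 0 = 0].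

Definition Jmx (R : realType) : 'M[R]_(3 + 3) :=
  block_mx 0 (- 1%:M) 1%:M 0.

Definition Sp6 (R : realType) : set 'M[R]_(3 + 3) :=
  [set g | g \in unitmx /\ g *m Jmx R *m g^T = Jmx R].

(* The group G, identified with the identity component of the group of
   holomorphic automorphisms of the tube domain V + i cone. *)
Definition groupG (R : realType) : set 'M[R]_(3 + 3) :=
  [set g | Sp6 g /\
    [/\ setH' (ulsubmx g), spaceW (ursubmx g),
        spaceV' (dlsubmx g) & setH' (drsubmx g)^T]].

Definition mobius_den (R : realType) (g : 'M[R]_(3 + 3)) (x : 'M[R]_3) :
    'M[R]_3 :=
  dlsubmx g *m x + drsubmx g.

(* Meaningful only when mobius_den g x is invertible, since invmx is the
   identity on singular matrices. *)
Definition mobius (R : realType) (g : 'M[R]_(3 + 3)) (x : 'M[R]_3) :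
    'M[R]_3 :=
  (ulsubmx g *m x + ursubmx g) *m invmx (mobius_den g x).

Definition compression (R : realType) : set 'M[R]_(3 + 3) :=
  [set g | groupG g /\
    forall x, cone x -> mobius_den g x \in unitmx /\ cone (mobius g x)].

Definition transl (R : realType) (v : 'M[R]_3) : 'M[R]_(3 + 3) :=
  block_mx 1%:M v 0 1%:M.

Definition rho (R : realType) (A : 'M[R]_3) : 'M[R]_(3 + 3) :=
  block_mx A 0 0 (invmx A^T).

Definition transl_opp (R : realType) (u : 'M[R]_3) : 'M[R]_(3 + 3) :=
  block_mx 1%:M 0 (- u) 1%:M.

Definition groupG0 (R : realType) : set 'M[R]_(3 + 3) :=
  @rho R @` @groupH R.

Definition Gamma_plus (R : realType) : set 'M[R]_(3 + 3) :=
  @transl R @` @cone_closure R.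

Definition Gamma_minus (R : realType) : set 'M[R]_(3 + 3) :=
  [set transl_opp (- u) | u in @cone_closure R `&` @spaceV' R].

Definition Upsilon (R : realType) : set 'M[R]_(3 + 3) :=
  [set g | exists v A u, [/\ spaceV v, groupH A, spaceV' u &
    g = transl v *m rho A *m transl_opp u]].

(* Main.v *)
(* The product set lies in the compression semigroup because translations by the
   closed cone, congruences by H and x |-> (x^-1 + p)^-1 with p >= 0 all preserve
   the cone, and compressions compose. Conversely, along the scalar matrices
   x = t 1 the k-th diagonal entry (k = 1, 2) of g . x is a real Moebius map of
   determinant 1 sending t > 0 to positive values, which forces d_k <> 0 and
   c_k / d_k >= 0. So D is invertible and g = t_v rho(A) t~_{-p} with v = B D^-1
   and p = D^-1 C >= 0; letting t tend to 0, g . (t 1) tends to v, so v is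
   positive semidefinite. *)
Require Import Defs.
From mathcomp Require Import all_boot all_order all_algebra.
From mathcomp Require Import all_classical all_reals all_analysis.
From mathcomp Require Import ring lra.

Set Implicit Arguments.
Unset Strict Implicit.
Unset Printing Implicit Defensive.

Import Order.TTheory GRing.Theory Num.Theory.
Import numFieldNormedType.Exports.

Local Open Scope classical_set_scope.
Local Open Scope ring_scope.

(** * Positive definite and semidefinite forms, congruence and resolvents *)

Definition possemidefmx (R : realType) n (x : 'M[R]_n) : Prop :=
  x^T = x /\ forall w : 'cV[R]_n, 0 <= (w^T *m x *m w) 0 0.

Section QuadraticForms.
Variables (R : realType) (n : nat).
Implicit Types (x y p : 'M[R]_n) (w : 'cV[R]_n).

Lemma quadformE x w :
  (w^T *m x *m w) 0 0 = \sum_j (\sum_i w i 0 * x i j) * w j 0.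
Proof.
rewrite mxE; apply: eq_bigr => j _; rewrite mxE; congr (_ * _).
by apply: eq_bigr => i _; rewrite mxE.
Qed.

Lemma quadformD x y w :
  (w^T *m (x + y) *m w) 0 0 = (w^T *m x *m w) 0 0 + (w^T *m y *m w) 0 0.
Proof. by rewrite mulmxDr mulmxDl mxE. Qed.

Lemma quadform_tr m (q : 'M[R]_(n, m)) x (w : 'cV[R]_m) :
  w^T *m (q^T *m x *m q) *m w = (q *m w)^T *m x *m (q *m w).
Proof. by rewrite trmx_mul !mulmxA. Qed.

Lemma quadform_scalar (t : R) w :
  (w^T *m t%:M *m w) 0 0 = t * (w^T *m w) 0 0.
Proof. by rewrite mul_mx_scalar -scalemxAl mxE. Qed.

Lemma sqnorm_gt0 w : w != 0 -> 0 < (w^T *m w) 0 0.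
Proof.
move=> w0; rewrite mxE lt_neqAle eq_sym sumr_ge0 ?andbT; last first.
  by move=> i _; rewrite mxE -expr2 sqr_ge0.
rewrite psumr_eq0; last by move=> i _; rewrite mxE -expr2 sqr_ge0.
apply: contra w0 => /allP h; apply/eqP/matrixP => i j; rewrite (ord1 j) mxE.
by have := h i (mem_index_enum i); rewrite /= mxE mulf_eq0 orbb => /eqP.
Qed.

Lemma posdefmx_semi x : posdefmx x -> possemidefmx x.
Proof.
case=> xT hx; split=> // w; have [->|w0] := eqVneq w 0; last exact/ltW/hx.
by rewrite mulmx0 mxE.
Qed.

Lemma posdefmx_scalar (t : R) : 0 < t -> posdefmx (t%:M : 'M[R]_n).
Proof.
move=> t0; split; first by rewrite tr_scalar_mx.
by move=> w /sqnorm_gt0 w0; rewrite quadform_scalar mulr_gt0.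
Qed.

Lemma posdefmxD x y : posdefmx x -> possemidefmx y -> posdefmx (x + y).
Proof.
move=> [xT hx] [yT hy]; split; first by rewrite linearD /= xT yT.
by move=> w w0; rewrite quadformD ltr_pwDl ?hx.
Qed.

Lemma possemidefmxD x y :
  possemidefmx x -> possemidefmx y -> possemidefmx (x + y).
Proof.
move=> [xT hx] [yT hy]; split; first by rewrite linearD /= xT yT.
by move=> w; rewrite quadformD addr_ge0.
Qed.

Lemma possemidefmx_congr m (q : 'M[R]_(n, m)) x :
  possemidefmx x -> possemidefmx (q^T *m x *m q).
Proof.
move=> [xT hx]; split; first by rewrite !trmx_mul trmxK xT mulmxA.
by move=> w; rewrite quadform_tr.
Qed.

Lemma mulmx_unit_eq0 (q : 'M[R]_n) w : q \in unitmx -> (q *m w == 0) = (w == 0).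
Proof.
move=> qu; apply/eqP/eqP => [h|->]; last by rewrite mulmx0.
by rewrite -(mulKmx qu w) h mulmx0.
Qed.

Lemma posdefmx_congr (q : 'M[R]_n) x :
  q \in unitmx -> posdefmx x -> posdefmx (q^T *m x *m q).
Proof.
move=> qu [xT hx]; split; first by rewrite !trmx_mul trmxK xT mulmxA.
by move=> w w0; rewrite quadform_tr; apply: hx; rewrite mulmx_unit_eq0.
Qed.

Lemma congr_mxK (q : 'M[R]_n) x : q \in unitmx ->
  (invmx q)^T *m (q^T *m x *m q) *m invmx q = x.
Proof.
move=> qu; rewrite !mulmxA mulmxK // -trmx_mul mulmxV // trmx1.
by rewrite mul1mx.
Qed.

(* A row vector [v] with [v (x p + 1) = 0] satisfies [v x p x v^T + v x v^T = 0],
   a sum of two nonnegative terms. *)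
Lemma resolvent_unitmx x p : posdefmx x -> possemidefmx p ->
  p *m x + 1%:M \in unitmx.
Proof.
move=> [xT hx] [pT hp]; rewrite -unitmx_tr unitmxE unitfE; apply/det0P => -[v v0].
rewrite linearD /= trmx_mul trmx1 xT pT mulmxDr mulmx1 mulmxA => h.
have wv : v^T != 0 by rewrite -trmx0 (inj_eq trmx_inj).
have := hx _ wv; rewrite trmxK.
have /(congr1 (fun m : 'M[R]_1 => m 0 0)) : (v *m x *m p + v) *m (x *m v^T) = 0.
  by rewrite h mul0mx.
rewrite mulmxDl !mulmxA !mxE => e.
have := hp (x *m v^T); rewrite trmx_mul trmxK xT !mulmxA !mxE => h1 h2.
by move: e; apply/eqP; rewrite gt_eqF // ltr_wpDl.
Qed.

(** Here [y] is [(x^-1 + p)^-1], written without inverting [x]. Congruence by [q = p x + 1] clears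
    the inverse: [q^T y q = x + x p x] and [q^T (x - y) q = x p x + (p x)^T x (p x)]. The second
    conclusion says that the resolvent does not exceed [x]; it later bounds the image of a scalar
    matrix. *)
Lemma resolvent_posdef x p (y := x *m invmx (p *m x + 1%:M)) :
  posdefmx x -> possemidefmx p -> posdefmx y /\ possemidefmx (x - y).
Proof.
move=> hx hp; have qu := resolvent_unitmx hx hp; have [xT _] := hx.
have [pT _] := hp.
have qT : (p *m x + 1%:M)^T = x *m p + 1%:M.
  by rewrite linearD /= trmx_mul trmx1 xT pT.
have pxp : possemidefmx (x *m p *m x).
  by rewrite -[X in X *m p]xT; apply: possemidefmx_congr.
have yE : (p *m x + 1%:M)^T *m y *m (p *m x + 1%:M) = x + x *m p *m x.
  by rewrite /y mulmxA mulmxKV // qT mulmxDl mul1mx addrC.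
have dE : (p *m x + 1%:M)^T *m (x - y) *m (p *m x + 1%:M) =
          x *m p *m x + (p *m x)^T *m x *m (p *m x).
  rewrite mulmxBr mulmxBl yE qT mulmxDl mul1mx mulmxDr mulmx1 mulmxDl.
  by rewrite trmx_mul xT pT !mulmxA [x + x *m p *m x]addrC addrK addrC.
split.
  by rewrite -(congr_mxK y qu) yE; apply: posdefmx_congr;
     [rewrite unitmx_inv|apply: posdefmxD].
rewrite -(congr_mxK (x - y) qu) dE; apply: possemidefmx_congr.
by apply: possemidefmxD => //; apply/possemidefmx_congr/posdefmx_semi.
Qed.

Lemma diag_ge0 x i : possemidefmx x -> 0 <= x i i.
Proof.
case=> _ /(_ (delta_mx i 0)).
by rewrite trmx_delta -rowE -colE !mxE.
Qed.

Lemma diag_gt0 x i : posdefmx x -> 0 < x i i.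
Proof.
case=> _ /(_ (delta_mx i 0)).
rewrite trmx_delta -rowE -colE !mxE; apply.
by apply/eqP => /matrixP /(_ i 0) /eqP; rewrite !mxE !eqxx oner_eq0.
Qed.

Lemma diag_possemidef x :
  is_diag_mx x -> (forall i, 0 <= x i i) -> possemidefmx x.
Proof.
move=> /is_diag_mxP dx hx; split.
  apply/matrixP => i j; rewrite mxE; have [->//|ij] := eqVneq i j.
  by rewrite !dx // eq_sym.
move=> w; rewrite quadformE; apply: sumr_ge0 => j _.
rewrite (bigD1 j) //= big1 ?addr0; last by move=> i ij; rewrite dx ?mulr0.
by rewrite mulrAC -expr2 mulr_ge0 // sqr_ge0.
Qed.

Lemma continuous_quadform w :
  continuous (fun x => (w^T *m x *m w) 0 0).
Proof.
move=> x; rewrite (_ : (fun _ => _) =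
  fun y : 'M[R]_n => \sum_j (\sum_i w i 0 * y i j) * w j 0); last first.
  by apply/funext => y; rewrite quadformE.
(* The form is a finite sum of coordinate functions with constant factors, so continuity of finite
   sums settles it. *)
have sumC (I : finType) (f : I -> 'M[R]_n -> R) :
  (forall i, {for x, continuous (f i)}) ->
  {for x, continuous (fun y => \sum_i f i y)}.
  move=> hf; rewrite (_ : (fun _ => _) = \sum_i f i); last first.
    by apply/funext => y; rewrite fct_sumE.
  elim/big_ind: _ => [|f1 f2 h1 h2|i _]; last exact: hf.
  - exact: (@cst_continuous _ _ (0 : R)).
  - exact: continuousD.
apply: (sumC _ _) => j; apply: continuousM; last exact: cst_continuous.
apply: sumC => i; apply: continuousM; first exact: cst_continuous.
exact: coord_continuous.
Qed.

End QuadraticForms.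

(** * The closed cone as the semidefinite matrices in V *)

Lemma cone_closureP (R : realType) (v : 'M[R]_3) :
  cone_closure v <-> spaceV v /\ possemidefmx v.
Proof.
split=> [[Vv cv]|[Vv pv]].
  split=> //; split; first by case: Vv.
  (* For fixed [w], the cone lies in a closed half-space, which therefore contains its closure. *)
  move=> w; have cl : closed [set x : 'M[R]_3 | 0 <= (w^T *m x *m w) 0 0].
    by apply: (@preimage_closed _ _ (fun x : 'M[R]_3 => (w^T *m x *m w) 0 0)
        [set t : R | 0 <= t]);
      [move=> x _; exact: continuous_quadform|exact: closed_ge].
  move/closure_id : cl => cl.
  suff : closure [set x : 'M[R]_3 | 0 <= (w^T *m x *m w) 0 0] v by rewrite -cl.
  apply: closureS cv => x [_ /posdefmx_semi [_]]; exact.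
split=> // B nB.
(* Conversely, [v] is the limit of the cone points [v + t 1] as [t] decreases to 0; inside a given
   neighbourhood, half the radius [e] serves as [t]. *)
have cv : (fun t : R => v + t *: 1%:M) @ (0 : R) --> v + 0 *: 1%:M.
  by apply: cvgD; [exact: cvg_cst|apply: cvgZ; [exact: cvg_id|exact: cvg_cst]].
rewrite scale0r addr0 in cv.
have /nbhs_ballP [e /= e0 he] := cv _ nB.
exists (v + (e / 2) *: 1%:M); split; last first.
  apply: he; rewrite /ball /= sub0r normrN gtr0_norm ?divr_gt0 //.
  by rewrite ltr_pdivrMr // ltr_pMr // ltr1n.
case: Vv => vT v01; split; first split.
- by rewrite linearD /= linearZ /= trmx1 vT.
- by rewrite !mxE v01 mulr0 addr0.
rewrite scalemx1 addrC; apply: posdefmxD => //.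
by apply: posdefmx_scalar; rewrite divr_gt0.
Qed.

(** * Zero patterns of the blocks, and stability of H and G *)

Section Entries.
Variable R : realType.
Implicit Types (A B C D u x : 'M[R]_3).

Lemma ord3P (i : 'I_3) : [\/ i = 0, i = 1 | i = 2].
Proof.
by case: i => -[|[|[|//]]] h;
  [apply: Or31|apply: Or32|apply: Or33]; apply: val_inj.
Qed.

(** With the sum expanded, rewriting by the vanishing entries of the factors decides the zero
    pattern of a product. *)
Lemma mulmx3E m n (A : 'M[R]_(m, 3)) (B : 'M[R]_(3, n)) i j :
  (A *m B) i j = A i 0 * B 0 j + A i 1 * B 1 j + A i 2 * B 2 j.
Proof.
rewrite mxE !big_ord_recl big_ord0 addr0 addrA.
by congr (_ * _ + _ * _ + _ * _);
  [congr (A _ _)|congr (B _ _)|congr (A _ _)|congr (B _ _)]; apply: val_inj.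
Qed.

Lemma spaceV'P u :
  spaceV' u <-> [/\ [/\ u 0 1 = 0, u 0 2 = 0 & u 1 0 = 0],
                    [/\ u 1 2 = 0, u 2 0 = 0 & u 2 1 = 0] & u 2 2 = 0].
Proof.
split=> [[/is_diag_mxP d u2]|[[? ? ?] [? ? ?] ?]];
  first by split=> //; split; apply: d.
split=> //; apply/is_diag_mxP => i j.
by case: (ord3P i) => ->; case: (ord3P j) => ->.
Qed.

Lemma spaceV'_tr u : spaceV' u -> u^T = u.
Proof.
case/spaceV'P => -[? ? ?] [? ? ?] ?; apply/matrixP => i j; rewrite mxE.
by case: (ord3P i) => ->; case: (ord3P j) => ->; congruence.
Qed.

Lemma groupH_inv A : groupH A -> A \in unitmx /\ groupH (invmx A).
Proof.
case=> -[a01 a10 a02 a12 a2]; rewrite mulf_eq0 negb_or => /andP[a0 a1].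
have a2' : A 2 2 != 0 by rewrite gt_eqF.
(* The inverse is written out by solving the lower triangular system: reciprocals on the diagonal,
   and corrections only in the last row. Membership in H can then be read off its entries. *)
pose B : 'M[R]_3 := \matrix_(i, j)
  if i == j then (A i i)^-1 else
  if i == 2 then - A 2 j / (A j j * A 2 2) else 0.
have AB : A *m B = 1%:M.
  apply/matrixP => i j; rewrite mulmx3E !mxE.
  by case: (ord3P i) => ->; case: (ord3P j) => ->;
    rewrite /= ?a01 ?a10 ?a02 ?a12 ?mul0r ?add0r ?addr0 ?mulr0 ?mulfV //; field;
    rewrite ?a0 ?a1 ?a2'.
have [Au _] := mulmx1_unit AB.
have -> : invmx A = B by rewrite -[LHS]mulmx1 -AB mulKmx.
by split=> //; split; [split|];
  rewrite !mxE //= ?invr_gt0 // mulf_neq0 ?invr_neq0.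
Qed.

Lemma Sp6_mul (g h : 'M[R]_(3 + 3)) : Sp6 g -> Sp6 h -> Sp6 (g *m h).
Proof.
move=> [gu gJ] [hu hJ]; split; first by rewrite unitmx_mul gu.
by rewrite trmx_mul mulmxA -(mulmxA g) -(mulmxA g) hJ.
Qed.

Lemma setH'_trP D :
  setH' D^T <-> [/\ D 1 0 = 0, D 0 1 = 0, D 2 0 = 0, D 2 1 = 0 & 0 < D 2 2].
Proof. by rewrite /setH' /= !mxE. Qed.

Lemma groupG_block A B C D :
  groupG (block_mx A B C D) <->
  Sp6 (block_mx A B C D) /\ [/\ setH' A, spaceW B, spaceV' C & setH' D^T].
Proof.
by rewrite /groupG /= block_mxKul block_mxKur block_mxKdl block_mxKdr.
Qed.

Lemma groupG_mul (g h : 'M[R]_(3 + 3)) :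
  groupG g -> groupG h -> groupG (g *m h).
Proof.
rewrite -(submxK g) -(submxK h).
move: (ulsubmx g) (ursubmx g) (dlsubmx g) (drsubmx g) => A B C D.
move: (ulsubmx h) (ursubmx h) (dlsubmx h) (drsubmx h) => A' B' C' D'.
move=> /groupG_block [gS [[a1 a2 a3 a4 a5] [b1 b2]]].
move=> /spaceV'P [[c1 c2 c3] [c4 c5 c6] c7] /setH'_trP [d1 d2 d3 d4 d5].
move=> /groupG_block [hS [[a1' a2' a3' a4' a5'] [b1' b2']]].
move=> /spaceV'P [[c1' c2' c3'] [c4' c5' c6'] c7'].
move=> /setH'_trP [d1' d2' d3' d4' d5'].
(* A tuple of equations acts as one rewrite rule, so all sixteen entry conditions on the product
   blocks are handled uniformly. In both positivity conditions the last diagonal entry of the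
   product block is the product of those of the factors. *)
have z := (a1, a2, a3, a4, b1, b2, c1, c2, c3, c4, c5, c6, c7, d1, d2, d3, d4).
have z' := (a1', a2', a3', a4', b1', b2', c1', c2', c3', c4', c5', c6', c7',
            d1', d2', d3', d4').
have := Sp6_mul gS hS; rewrite mulmx_block => ghS; apply/groupG_block.
split=> //; split; [split|split|apply/spaceV'P; split; try split|
  apply/setH'_trP; split];
  by rewrite mxE !mulmx3E ?z ?z' ?(mul0r, mulr0, addr0, add0r) ?mulr_gt0.
Qed.

End Entries.

(** * The linear fractional action, and compressions among its generators *)

Section Mobius.
Variable R : realType.
Implicit Types (A u v x p : 'M[R]_3) (g h : 'M[R]_(3 + 3)).

Lemma submx_mul g h :
  [/\ ulsubmx (g *m h) = ulsubmx g *m ulsubmx h + ursubmx g *m dlsubmx h,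
      ursubmx (g *m h) = ulsubmx g *m ursubmx h + ursubmx g *m drsubmx h,
      dlsubmx (g *m h) = dlsubmx g *m ulsubmx h + drsubmx g *m dlsubmx h &
      drsubmx (g *m h) = dlsubmx g *m ursubmx h + drsubmx g *m drsubmx h].
Proof.
have -> : g *m h = block_mx (ulsubmx g) (ursubmx g) (dlsubmx g) (drsubmx g) *m
    block_mx (ulsubmx h) (ursubmx h) (dlsubmx h) (drsubmx h) by rewrite !submxK.
by rewrite mulmx_block block_mxKul block_mxKur block_mxKdl block_mxKdr.
Qed.

(** The cocycle identity of the denominator [C x + D]; it transfers invertibility of denominators to
    products. *)
Lemma mobius_denM g h x : mobius_den h x \in unitmx ->
  mobius_den (g *m h) x = mobius_den g (mobius h x) *m mobius_den h x.
Proof.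
move=> hu; rewrite mulmxDl -mulmxA mulmxKV // /mobius_den.
have [_ _ -> ->] := submx_mul g h.
by rewrite !mulmxDr !mulmxDl !mulmxA addrACA.
Qed.

Lemma mobiusM g h x :
  mobius_den h x \in unitmx -> mobius_den g (mobius h x) \in unitmx ->
  mobius (g *m h) x = mobius g (mobius h x).
Proof.
move=> hu gu; have ghu : mobius_den (g *m h) x \in unitmx.
  by rewrite mobius_denM // unitmx_mul gu.
apply: (canLR (mulmxK ghu)); rewrite mobius_denM // mulmxA mulmxKV //.
rewrite mulmxDl -mulmxA mulmxKV // /mobius_den.
have [-> -> _ _] := submx_mul g h.
by rewrite !mulmxDr !mulmxDl !mulmxA addrACA.
Qed.

Lemma compression_mul g h :
  compression g -> compression h -> compression (g *m h).
Proof.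
move=> [Gg hg] [Gh hh]; split=> [|x /hh [hu /hg [gu gx]]].
  exact: groupG_mul.
by rewrite mobius_denM // mobiusM // unitmx_mul gu.
Qed.

Lemma mobius_den_transl v x : mobius_den (transl v) x = 1%:M.
Proof. by rewrite /mobius_den block_mxKdl block_mxKdr mul0mx add0r. Qed.

Lemma mobius_transl v x : mobius (transl v) x = x + v.
Proof.
by rewrite /mobius mobius_den_transl invmx1 mulmx1 block_mxKul block_mxKur mul1mx.
Qed.

Lemma mobius_den_rho A x : mobius_den (rho A) x = invmx A^T.
Proof. by rewrite /mobius_den block_mxKdl block_mxKdr mul0mx add0r. Qed.

Lemma mobius_rho A x : mobius (rho A) x = A *m x *m A^T.
Proof. by rewrite /mobius mobius_den_rho invmxK block_mxKul block_mxKur addr0. Qed.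

Lemma mobius_den_transl_opp u x : mobius_den (transl_opp u) x = - u *m x + 1%:M.
Proof. by rewrite /mobius_den block_mxKdl block_mxKdr. Qed.

Lemma mobius_transl_opp u x :
  mobius (transl_opp u) x = x *m invmx (- u *m x + 1%:M).
Proof.
by rewrite /mobius mobius_den_transl_opp block_mxKul block_mxKur mul1mx addr0.
Qed.

Lemma cone_resolvent x p : cone x -> spaceV' p -> possemidefmx p ->
  [/\ p *m x + 1%:M \in unitmx, cone (x *m invmx (p *m x + 1%:M)) &
      possemidefmx (x - x *m invmx (p *m x + 1%:M))].
Proof.
move=> [[xT x01] px] Vp pp; have qu := resolvent_unitmx px pp.
have [py sy] := resolvent_posdef px pp.
split=> //; split=> //; split; first by case: py.
set y := x *m _.
(* It remains to see that [y] stays in V. Since [p] is diagonal and [x 0 1 = 0], this entry of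
   [y (p x + 1) = x] reduces to [y 0 1 * (p 1 1 * x 1 1 + 1) = 0], whose second factor is
   positive. *)
have : (y *m (p *m x + 1%:M)) 0 1 = 0 by rewrite mulmxKV.
case/spaceV'P: Vp => -[p01 p02 p10] [p12 p20 p21] p22.
rewrite -/y; move: (y) => {}y.
rewrite !(mulmx3E, mxE) p01 p02 p10 p12 p20 p21 p22 x01 /=.
rewrite !(mul0r, mulr0, addr0, add0r) => /eqP; rewrite mulf_eq0 => /orP[/eqP //|].
by rewrite gt_eqF // ltr_wpDl // mulr_ge0 ?diag_ge0 //; apply: posdefmx_semi.
Qed.

Lemma Sp6_transl v : v^T = v -> Sp6 (transl v).
Proof.
move=> vT; split; first by rewrite unitmxE det_ublock !det1 mulr1 unitr1.
rewrite /transl /Jmx tr_block_mx !mulmx_block !trmx1 trmx0 vT.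
by rewrite !(mul0mx, mulmx0, mul1mx, mulmx1, add0r, addr0, mulmxN, mulNmx) addrN.
Qed.

Lemma Sp6_rho A : A \in unitmx -> Sp6 (rho A).
Proof.
move=> Au; split.
  by rewrite unitmxE det_ublock unitrM -!unitmxE Au unitmx_inv unitmx_tr.
rewrite /rho /Jmx tr_block_mx !mulmx_block !trmx0.
rewrite !(mul0mx, mulmx0, mul1mx, mulmx1, add0r, addr0, mulmxN, mulNmx).
by rewrite trmx_inv trmxK mulmxV // mulVmx ?unitmx_tr.
Qed.

Lemma Sp6_transl_opp u : u^T = u -> Sp6 (transl_opp u).
Proof.
move=> uT; split; first by rewrite unitmxE det_lblock !det1 mulr1 unitr1.
have uNT : (- u)^T = - u by rewrite linearN /= uT.
rewrite /transl_opp /Jmx tr_block_mx !mulmx_block !trmx1 trmx0 uNT.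
by rewrite !(mul0mx, mulmx0, mul1mx, mulmx1, add0r, addr0, mulmxN, mulNmx,
  opprK) addNr.
Qed.

Lemma setH'_1 : setH' (1%:M : 'M[R]_3).
Proof. by split; rewrite !mxE. Qed.

Lemma compression_transl v : cone_closure v -> compression (transl v).
Proof.
case/cone_closureP => -[vT v01] pv; split.
  apply/groupG_block; split; first exact: Sp6_transl.
  split; rewrite ?trmx1; [exact: setH'_1| | |exact: setH'_1].
    by split=> //; rewrite -vT mxE.
  by apply/spaceV'P; rewrite !mxE.
move=> x [[xT x01] px]; rewrite mobius_den_transl mobius_transl unitmx1.
split=> //; split; last exact: posdefmxD.
by split; rewrite ?linearD /= ?xT ?vT // mxE x01 v01 addr0.
Qed.

Lemma compression_rho A : groupH A -> compression (rho A).
Proof.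
move=> HA; have [Au [HA' _]] := groupH_inv HA.
case: (HA) => -[a01 a10 a02 a12 a2] _.
split.
  apply/groupG_block; split; first exact: Sp6_rho.
  split=> //; last by rewrite trmx_inv trmxK.
    by split; rewrite mxE.
  by apply/spaceV'P; rewrite !mxE.
move=> x [[xT x01] px]; rewrite mobius_den_rho mobius_rho unitmx_inv unitmx_tr.
have pA : posdefmx (A *m x *m A^T).
  by rewrite -{1}[A]trmxK; apply: posdefmx_congr; rewrite ?unitmx_tr.
split=> //; split=> //; split; first by case: pA.
rewrite !mulmx3E !mxE a01 a10 a02 a12 x01.
by rewrite !(mul0r, mulr0, addr0, add0r).
Qed.

(** The two signs cancel: the lower left block is [p] itself, so the action is
    [x |-> x (p x + 1)^-1], the resolvent studied above. *)
Lemma compression_transl_opp p :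
  spaceV' p -> possemidefmx p -> compression (transl_opp (- p)).
Proof.
move=> Vp pp; split.
  apply/groupG_block; rewrite opprK; split.
    by rewrite -[p]opprK; apply: Sp6_transl_opp; rewrite linearN /= spaceV'_tr.
  by split; rewrite ?trmx1; [exact: setH'_1|split; rewrite mxE| |exact: setH'_1].
move=> x xc; rewrite mobius_den_transl_opp mobius_transl_opp opprK.
by have [] := cone_resolvent xc Vp pp.
Qed.

End Mobius.

(** * Real Moebius maps preserving the positive half-line *)

Lemma mobius_line_pos (R : realType) (a b c d : R) :
  a * d - b * c = 1 ->
  (forall t, 0 < t -> exists2 y, 0 < y & y * (c * t + d) = a * t + b) ->
  d != 0 /\ 0 <= d^-1 * c.
Proof.
move=> det1 h; have d0 : d != 0.
  apply/eqP => d0; move: det1; rewrite d0 mulr0 sub0r => det1.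
  (* If [d = 0], then [b c = -1], and multiplying [y c t = a t + b] by [c] gives
     [y t c^2 = t a c - 1]. This [t] makes [t a c < 1] whatever the sign of [a c], so a nonnegative
     number would be negative. *)
  have t0 : 0 < (1 + (a * c) ^+ 2)^-1 by rewrite invr_gt0 ltr_pwDl // sqr_ge0.
  have [y y0] := h _ t0; set t := _^-1; rewrite d0 addr0 => e.
  have tE : t * (1 + (a * c) ^+ 2) = 1.
    by rewrite mulVf // gt_eqF // ltr_pwDl // sqr_ge0.
  have : 0 <= y * t * c ^+ 2.
    by apply: mulr_ge0; [apply/ltW/mulr_gt0|exact: sqr_ge0].
  have -> : y * t * c ^+ 2 = c * (y * (c * t)) by ring.
  rewrite e mulrDr [c * b]mulrC.
  have -> : b * c = - 1 by lra.
  have : t * (a * c) < 1.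
    by rewrite -tE ltr_pM2l //; nra.
  by lra.
split=> //; rewrite leNgt; apply/negP => neg.
have c0 : c != 0 by apply: contraTN neg => /eqP ->; rewrite mulr0 ltxx.
(* If [c / d < 0], the pole [t = - d / c] is positive. The hypothesis, stated without division, then
   forces [a t + b = 0]; multiplied by [c], this contradicts determinant 1. *)
have t0 : 0 < - (d^-1 * c)^-1 by rewrite oppr_gt0 invr_lt0.
have [y _] := h _ t0; rewrite invfM invrK.
have -> : c * - (d * c^-1) + d = 0 by field.
rewrite mulr0 => /(congr1 (fun z => z * c)); rewrite mul0r.
have -> : (a * - (d * c^-1) + b) * c = - (a * d - b * c) by field.
by rewrite det1 => /eqP; rewrite eq_sym oppr_eq0 oner_eq0.
Qed.

(** * Factorization of compressions and semidefiniteness of the factors *)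

Section Factorization.
Variable R : realType.
Implicit Types (A B C D u v x p : 'M[R]_3) (g h : 'M[R]_(3 + 3)).

Lemma Sp6_blockP A B C D : Sp6 (block_mx A B C D) ->
  [/\ B *m A^T = A *m B^T, A *m D^T = 1%:M + B *m C^T & D *m C^T = C *m D^T].
Proof.
case=> _; rewrite /Jmx tr_block_mx !mulmx_block.
rewrite !(mul0mx, mulmx0, mul1mx, mulmx1, add0r, addr0, mulmxN, mulNmx).
case/eq_block_mx => e1 e2 _ e4; split.
- by apply/eqP; rewrite -subr_eq0 e1.
- by rewrite -[1%:M]opprK -e2 opprB subrK.
- by apply/eqP; rewrite -subr_eq0 e4.
Qed.

Lemma spaceV_scalar (t : R) : spaceV (t%:M : 'M[R]_3).
Proof. by split; [rewrite tr_scalar_mx|rewrite !mxE]. Qed.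

Lemma cone_scalar (t : R) : 0 < t -> cone (t%:M : 'M[R]_3).
Proof. by move=> t0; split; [exact: spaceV_scalar|exact: posdefmx_scalar]. Qed.

Lemma compression_diag A B C D (k : 'I_3) : k != 2 ->
  compression (block_mx A B C D) -> D k k != 0 /\ 0 <= (D k k)^-1 * C k k.
Proof.
move=> k2 [/groupG_block [gS [[a1 a2 a3 a4 a5] [b1 b2]]]].
move=> /spaceV'P [[c1 c2 c3] [c4 c5 c6] c7] /setH'_trP [d1 d2 d3 d4 d5] hg.
have z := (a1, a2, a3, a4, b1, b2, c1, c2, c3, c4, c5, c6, c7, d1, d2, d3, d4).
(* By the zero patterns, the [(k, k)] entry of [A D^T = 1 + B C^T] is the determinant condition of
   the scalar Moebius map. *)
have [_ /(congr1 (fun m : 'M[R]_3 => m k k)) AD _] := Sp6_blockP gS.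
apply: (@mobius_line_pos R (A k k) (B k k)).
  move: AD; rewrite !(mulmx3E, mxE) eqxx.
  by case: (ord3P k) k2 => -> //= _;
    rewrite ?z !(mul0r, mulr0, addr0, add0r) => ->; rewrite addrK.
move=> t /cone_scalar /hg [gu [_ py]]; exists (mobius (block_mx A B C D) t%:M k k).
  exact: diag_gt0.
(* For [k] other than 2, column [k] of [t C + D] has only its diagonal entry, so the [(k, k)] entry
   of this product involves only the [(k, k)] entry of the image. *)
have : mobius (block_mx A B C D) t%:M *m mobius_den (block_mx A B C D) t%:M
    = A *m t%:M + B by rewrite mulmxKV // block_mxKul block_mxKur.
rewrite /mobius_den block_mxKdl block_mxKdr !mul_mx_scalar.
move: (mobius _ _) => y /(congr1 (fun m : 'M[R]_3 => m k k)).
rewrite !(mulmx3E, mxE).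
by case: (ord3P k) k2 => -> //= _;
  rewrite ?z !(mul0r, mulr0, addr0, add0r) [t * C _ _]mulrC [t * A _ _]mulrC.
Qed.

Lemma compression_factor g : compression g ->
  exists v A p, [/\ spaceV v, groupH A, spaceV' p, possemidefmx p &
    g = transl v *m rho A *m transl_opp (- p)].
Proof.
rewrite -(submxK g).
move: (ulsubmx g) (ursubmx g) (dlsubmx g) (drsubmx g) => A B C D Gg.
have h0 := @compression_diag A B C D 0 isT Gg.
have h1 := @compression_diag A B C D 1 isT Gg.
case: Gg => /groupG_block [gS [HA WB VC HDT]] _.
have [BA AD DC] := Sp6_blockP gS.
have HD : groupH D^T by split=> //; rewrite !mxE mulf_neq0 //; tauto.
have [DTu HE] := groupH_inv HD; have Du : D \in unitmx by rewrite -unitmx_tr.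
have CT := spaceV'_tr VC; rewrite CT in AD DC.
set E := invmx D^T in HE; have ET : E^T = invmx D by rewrite trmx_inv trmxK.
have Vp : spaceV' (invmx D *m C).
  case/spaceV'P: VC => -[c1 c2 c3] [c4 c5 c6] c7.
  case: (HE) => -[e1 e2 e3 e4 e5] _.
  apply/spaceV'P; rewrite -ET !(mulmx3E, mxE) e1 e2 e3 e4 c1 c2 c3 c4 c5 c6 c7.
  by rewrite !(mul0r, mulr0, addr0, add0r).
have pT := spaceV'_tr Vp.
(* From [A D^T = 1 + B C] by right multiplication by [E], since the symmetry of [D^-1 C] gives
   [C E = D^-1 C]. *)
have AE : A = E + B *m (invmx D *m C).
  rewrite -pT trmx_mul CT trmx_inv -/E mulmxA -[in LHS](mulmxK DTu A) AD.
  by rewrite mulmxDl mul1mx.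
have DTE : D^T *m E = 1%:M by rewrite mulmxV.
(* Substituting [A = E + B p] with [p = D^-1 C] into [B A^T = A B^T], the term [B p B^T] cancels and
   [B E^T = E B^T] remains. *)
have vT : (B *m invmx D)^T = B *m invmx D.
  move: BA; rewrite AE linearD /= trmx_mul pT mulmxDl mulmxDr mulmxA.
  by rewrite ET trmx_mul trmx_inv -/E => /addIr ->.
exists (B *m invmx D), E, (invmx D *m C); split=> //.
- split=> //; case: HE => -[e1 e2 e3 e4 e5] _; case: WB => b1 b2.
  by rewrite -ET mulmx3E !mxE b1 e2 e4 !(mul0r, mulr0, addr0).
- apply: diag_possemidef; first by case: Vp.
  (* This identifies the first two diagonal entries of [D^-1 C] with the ratios found nonnegative by
     [compression_diag]. *)
  have DE k : k != 2 -> E k k = (D k k)^-1.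
    move=> k2; have Dk : D k k != 0 by case: (ord3P k) k2 => -> //= _; tauto.
    apply: (mulfI Dk); rewrite mulfV //.
    have /(congr1 (fun m : 'M[R]_3 => m k k)) := DTE.
    rewrite !(mulmx3E, mxE) eqxx; case: HDT; rewrite !mxE => d1 d2 d3 d4 _.
    by case: (ord3P k) k2 => -> //= _;
      rewrite ?d1 ?d2 ?d3 ?d4 !(mul0r, addr0, add0r).
  move=> i; case/spaceV'P: VC => -[c1 c2 c3] [c4 c5 c6] c7.
  case: (HE) => -[e1 e2 e3 e4 e5] _.
  by case: (ord3P i) => ->; rewrite -ET !(mulmx3E, mxE) ?c1 ?c2 ?c3 ?c4 ?c5 ?c6 ?c7
    !(mulr0, addr0, add0r) ?DE //; tauto.
- rewrite /transl /rho /transl_opp opprK ET invmxK !mulmx_block.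
  rewrite !(mul0mx, mulmx0, mul1mx, mulmx1, add0r, addr0).
  by rewrite mulmxKV // mulKVmx // -AE.
Qed.

Lemma mobius_factor v A p x :
  A \in unitmx -> p *m x + 1%:M \in unitmx ->
  mobius (transl v *m rho A *m transl_opp (- p)) x =
  A *m (x *m invmx (p *m x + 1%:M)) *m A^T + v.
Proof.
move=> Au qu; have du y : mobius_den (rho A) y \in unitmx.
  by rewrite mobius_den_rho unitmx_inv unitmx_tr.
have tu y : mobius_den (transl v) y \in unitmx.
  by rewrite mobius_den_transl unitmx1.
rewrite mobiusM ?mobius_den_transl_opp ?mobius_denM ?unitmx_mul ?tu ?du ?opprK //.
by rewrite mobiusM // mobius_transl mobius_rho mobius_transl_opp opprK.
Qed.

(** An explicit bound plays the part of the limit at 0: the image of [t 1] is [A y A^T + v] with [y]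
    at most [t 1], so its positivity at [w] gives [0 < t |A^T w|^2 + w^T v w] for every [t > 0]. *)
Lemma translation_part_possemidef v A p :
  v^T = v -> A \in unitmx -> spaceV' p -> possemidefmx p ->
  compression (transl v *m rho A *m transl_opp (- p)) -> possemidefmx v.
Proof.
move=> vT Au Vp pp [_ hg]; split=> // w.
have [->|w0] := eqVneq w 0; first by rewrite mulmx0 mxE.
rewrite leNgt; apply/negP => vw.
set N := ((A^T *m w)^T *m (A^T *m w)) 0 0.
have N0 : 0 < N by apply: sqnorm_gt0; rewrite mulmx_unit_eq0 ?unitmx_tr.
have ineq t : 0 < t -> 0 < t * N + (w^T *m v *m w) 0 0.
  move=> t0; have xc := cone_scalar t0.
  have [qu _ [_ /(_ (A^T *m w))]] := cone_resolvent xc Vp pp.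
  have [_ [_ [_ /(_ w w0)]]] := hg _ xc; rewrite mobius_factor //.
  move: (_ *m invmx _) => y; rewrite [X in 0 < X -> _]quadformD.
  have := quadform_tr A^T y w; rewrite trmxK => -> vy.
  rewrite quadformD quadform_scalar -/N mulmxN mulNmx [X in _ + X]mxE => ty.
  by lra.
(* If [w^T v w] were negative, this positive [t] would make the bound exactly 0. *)
have := ineq (- (w^T *m v *m w) 0 0 / N).
by rewrite divr_gt0 ?oppr_gt0 // divfK ?gt_eqF // addNr ltxx => /(_ isT).
Qed.

End Factorization.

Theorem theorem3p1 (R : realType) :
  @compression R `<=` @Upsilon R /\
  @compression R =
    [set g | exists gp h gm,
      [/\ @Gamma_plus R gp, @groupG0 R h, @Gamma_minus R gm &
          g = gp *m h *m gm]].
Proof.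
split=> [g /compression_factor [v [A [p [Vv HA Vp pp ->]]]]|].
  (* The sign of [p] changes because [Upsilon] is parametrized by [transl_opp u], while the
     factorization uses [transl_opp (- p)]. *)
  exists v, A, (- p); split=> //.
  case/spaceV'P: Vp => -[p1 p2 p3] [p4 p5 p6] p7; apply/spaceV'P.
  by rewrite !mxE p1 p2 p3 p4 p5 p6 p7 oppr0.
apply/seteqP; split=> [g Gg|_ [_ [_ [_ [[v cv <-] [A HA <-] [p [cp Vp] <-] ->]]]]].
  have [v [A [p [Vv HA Vp pp gE]]]] := compression_factor Gg.
  have [Au _] := groupH_inv HA; rewrite gE in Gg.
  exists (transl v), (rho A), (transl_opp (- p)); split=> //.
  - exists v => //; apply/cone_closureP; split=> //.
    by apply: translation_part_possemidef Gg => //; case: Vv.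
  - by exists A.
  - exists p => //; split=> //; apply/cone_closureP; split=> //.
    split; first exact: spaceV'_tr.
    by case/spaceV'P: Vp => -[].
(* For the reverse inclusion, each of the three factors is a compression. *)
have [_ pp] := (cone_closureP p).1 cp.
apply: compression_mul; last exact: compression_transl_opp.
apply: compression_mul; first exact: compression_transl.
exact: compression_rho.
Qed.
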